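(* Let $I\subset R=K[x_1,\ldots,x_n]$ be a (proper) monomial ideal with polarization $I(\mathrm{pol})\subset R(\mathrm{pol})$. Suppose there exists an associated prime $\mathfrak{p}=\langle x_{s_1,b_{s_1}},\ldots,x_{s_k,b_{s_k}}\rangle\in\mathrm{Ass}(I(\mathrm{pol}))$ such that $\mathrm{v}(I(\mathrm{pol}))=\mathrm{v}_{\mathfrak{p}}(I(\mathrm{pol}))$ and there is no embedded prime of $I$ properly containing $\langle x_{s_1},\ldots,x_{s_k}\rangle$. Then $\mathrm{v}(I)=\mathrm{v}(I(\mathrm{pol}))$.
   Context: $K$ is a field and polynomial rings over $K$ have the standard grading; $R_d$ denotes the degree-$d$ homogeneous component of a polynomial ring $R$. $\mathrm{Ass}(I)=\mathrm{Ass}(R/I)$ is the set of associated primes of $I$; an embedded prime of $I$ is an associated prime that is not minimal in $\mathrm{Ass}(I)$ under inclusion. For a proper graded ideal $I$ of $R$ and $\mathfrak{p}\in\mathrm{Ass}(I)$, $\mathrm{v}_{\mathfrak{p}}(I)=\min\{d\ge 0 : \exists f\in R_d \text{ with } (I:f)=\mathfrak{p}\}$, and $\mathrm{v}(I)=\min\{\mathrm{v}_{\mathfrak{p}}(I):\mathfrak{p}\in\mathrm{Ass}(I)\}$ (the v-number of $I$). For a monomial $\mathbf{x}^{\mathbf{a}}=x_1^{a_1}\cdots x_n^{a_n}$, its polarization is $\mathbf{x}^{\mathbf{a}}(\mathrm{pol})=\prod_{i=1}^n\prod_{j=1}^{a_i}x_{i,j}$. For a monomial ideal $I$ with minimal monomial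 generating set $G(I)$, $I(\mathrm{pol})$ is the square-free monomial ideal generated by $\{u(\mathrm{pol}):u\in G(I)\}$ in $R(\mathrm{pol})=K[x_{i,j}: 1\le i\le n,\ 1\le j\le r_i]$, where $r_i$ is the exponent of $x_i$ in the lcm of the elements of $G(I)$. *)

(* Defs.v *)
From HB Require Import structures.
From mathcomp Require Import all_boot all_order all_algebra.
From mathcomp Require Import finmap.
From mathcomp Require Import mathcomp_extra boolp classical_sets functions.
From mathcomp Require Import cardinality.
From mathcomp Require Import mpoly.

Set Implicit Arguments.
Unset Strict Implicit.
Unset Printing Implicit Defensive.

Import Order.TTheory GRing.Theory.
Local Open Scope classical_set_scope.
Local Open Scope ring_scope.

Section Ideals.
Variable R : comNzRingType.
Implicit Types (I P Q S : set R) (f : R).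

(* [idealr_closed] includes 1 \notin I; this predicate is therefore about
   proper ideals. *)
Definition is_proper_ideal I : Prop := idealr_closed (mem I).

Definition is_prime_ideal P : Prop :=
  is_proper_ideal P /\ prime_idealr_closed (mem P).

(* A pair c in the list stands for the summand c.1 * c.2, c.2 in S. *)
Definition ideal_gen S : set R :=
  [set f | exists2 t : seq (R * R),
     {in t, forall c, S c.2} & f = \sum_(c <- t) c.1 * c.2].

Definition colon I f : set R := [set g | I (g * f)].

(* The associated primes of the module R/I. *)
Definition Ass I : set (set R) :=
  [set P | is_prime_ideal P /\ exists f, colon I f = P].

Definition embedded_prime I P : Prop :=
  Ass I P /\ exists2 Q, Ass I Q & Q `<` P.

End Ideals.

(* The minimum of A; it has the junk value 0 when A is empty, which does not
   occur below for proper graded ideals and their associated primes. *)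
Definition min_nat (A : set nat) : nat := xget 0%N (A `&` lbound A).

Lemma min_natP (A : set nat) d :
  A d -> A (min_nat A) /\ forall e, A e -> (min_nat A <= e)%N.
Proof.
move=> Ad; have exA : exists d', `[< A d' >] by exists d; apply/asboolP.
suff [] : (A `&` lbound A) (min_nat A) by split.
apply: xgetPex; exists (ex_minn exA); case: ex_minnP => m /asboolP Am le_m.
by split=> // e Ae; apply: le_m; apply/asboolP.
Qed.

Section VNumber.
Variables (K : fieldType) (n : nat).
Implicit Types (I P : set {mpoly K[n]}).

Definition vnum_at P I : nat :=
  min_nat [set d | exists2 f : {mpoly K[n]}, f \is d.-homog & colon I f = P].

Definition vnum I : nat := min_nat [set vnum_at P I | P in Ass I].

End VNumber.

Section MonomialIdeals.
Variables (K : fieldType) (n : nat).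
Implicit Types (I : set {mpoly K[n]}) (S : set 'X_{1..n}) (m : 'X_{1..n}).

Definition gen_by S : set {mpoly K[n]} := ideal_gen [set 'X_[m] | m in S].

Definition monomial_ideal I : Prop := exists S, I = gen_by S.

(* The minimal monomial generating set G(I): the monomials of I that are
   minimal for divisibility; see [mingens_gen] and [mingens_least]. *)
Definition mingens I : set 'X_{1..n} :=
  [set m | I 'X_[m] /\ forall m', I 'X_[m'] -> (m' <= m)%MM -> m' = m].

(* [mingens I] is always finite, by [mingens_finite]. *)
Definition lcm_gens I : 'X_{1..n} :=
  \big[@mlcm n/0%MM]_(m <- fset_set (mingens I)) m.

Lemma gen_byX S m : gen_by S 'X_[m] <-> exists2 s, S s & (s <= m)%MM.
Proof.
split=> [[t tS Xm]|[s Ss le_sm]]; last first.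
  exists [:: ('X_[m - s], 'X_[s])] => [c|]; last first.
    by rewrite big_seq1 -mpolyXD submK.
  by rewrite inE => /eqP -> /=; exists s.
have [c tc nz_c] : exists2 c, c \in t & (c.1 * c.2)@_m != 0.
  apply: contrapT => noc; suff : ('X_[K, m])@_m = 0.
    by rewrite mcoeffX eqxx => /eqP; rewrite oner_eq0.
  rewrite Xm raddf_sum /= big_seq big1 // => c tc.
  by apply/eqP/negPn/negP => nz; apply: noc; exists c.
case: (tS c tc) nz_c => s Ss <-; rewrite -mcoeff_msupp.
rewrite (perm_mem (msuppMX _ _)) => /mapP[m' _ ->].
by exists s => //; exact: lem_addr.
Qed.

Lemma mingens_below I m :
  I 'X_[m] -> exists2 s, mingens I s & (s <= m)%MM.
Proof.
have [k] := ubnP (mdeg m); elim: k m => // k IHk m lt_mk Im.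
have [minm|] := pselect (forall m', I 'X_[m'] -> (m' <= m)%MM -> m' = m).
  by exists m => //; exact: lepm_refl.
move=> /existsNP[m' /not_implyP[Im' /not_implyP[le_m'm ne_m'm]]].
have [|//|s Gs le_sm'] := IHk m'; last first.
  by exists s => //; exact: lepm_trans le_m'm.
rewrite -ltnS; apply: leq_trans lt_mk; rewrite ltnS.
have := submK le_m'm => defm; rewrite -defm mdegD -[ltnLHS]add0n ltn_add2r.
rewrite lt0n mdeg_eq0; apply/eqP => eq0; apply: ne_m'm.
by rewrite -defm eq0 add0m.
Qed.

Lemma gen_by_sub S T : (forall m, S m -> gen_by T 'X_[m]) ->
  gen_by S `<=` gen_by T.
Proof.
move=> sST f [t + ->] {f}; elim: t => [|c t IHt] tS.
  by exists [::]; rewrite ?big_nil.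
have [u uT defu] : gen_by T (\sum_(c0 <- t) c0.1 * c0.2).
  by apply: IHt => d td; apply: tS; rewrite inE td orbT.
have [m Sm defm] := tS c (mem_head _ _); have [v vT defv] := sST m Sm.
exists ([seq (c.1 * d.1, d.2) | d <- v] ++ u) => [d|].
  by rewrite mem_cat => /orP[/mapP[e /vT Te ->]|/uT].
rewrite big_cons big_cat big_map defu -defm defv big_distrr /=.
by congr (_ + _); apply: eq_bigr => d _; rewrite mulrA.
Qed.

Lemma mingens_gen I : monomial_ideal I -> I = gen_by (mingens I).
Proof.
move=> [S defI]; apply/seteqP; split; rewrite [in X in X `<=` _]defI.
  apply: gen_by_sub => m Sm; apply/gen_byX; apply: mingens_below.
  by rewrite defI; apply/gen_byX; exists m => //; exact: lepm_refl.
rewrite -defI [X in _ `<=` X]defI.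
by apply: gen_by_sub => m [Im _]; rewrite -defI.
Qed.

Lemma mingens_least S : mingens (gen_by S) `<=` S.
Proof.
move=> m [/gen_byX[s Ss le_sm] minm]; rewrite -(minm s) //.
by apply/gen_byX; exists s => //; exact: lepm_refl.
Qed.

Lemma nat_seq_mono (u : nat -> nat) : exists2 phi : nat -> nat,
  {homo phi : i j / (i < j)%N} & {homo u \o phi : i j / (i <= j)%N}.
Proof.
have tail N : exists k, (N <= k)%N /\ forall j, (N <= j)%N -> (u k <= u j)%N.
  pose A := [set u k | k in [set k | (N <= k)%N]].
  have [|[k Nk <-] le_k] := @min_natP A (u N); first by exists N => /=.
  by exists k; split=> // j Nj; apply: le_k; exists j.
have [g gP] := choice tail; pose phi := fix F i :=
  if i is i'.+1 then g (F i').+1 else g 0%N.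
have lt_phi : {homo phi : i j / (i < j)%N}.
  apply: homo_ltn => [|i]; first exact: ltn_trans.
  by case: (gP (phi i).+1).
exists phi => //; apply: homo_leq => [//||i]; first exact: leq_trans.
case: i => [|i] /=; first by case: (gP 0%N) => _; apply.
case: (gP (phi i).+1) => _; apply; apply: ltn_trans (lt_phi i i.+1 _) _ => //.
exact: (lt_phi i.+1 i.+2).
Qed.

Lemma multinom_good_pair (u : nat -> 'X_{1..n}) :
  exists i j, (i < j)%N /\ (u i <= u j)%MM.
Proof.
suff [phi lt_phi le_phi] : exists2 phi : nat -> nat,
    {homo phi : i j / (i < j)%N} &
    forall x, x \in enum 'I_n ->
      {homo (fun i => u (phi i) x) : i j / (i <= j)%N}.
  exists (phi 0%N), (phi 1%N); split; first exact: lt_phi.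
  by apply/mnm_lepP => x; apply: (le_phi x) => //; rewrite mem_enum.
elim: (enum 'I_n) => [|x s [phi lt_phi le_phi]]; first by exists id.
have [psi lt_psi le_psi] := nat_seq_mono (fun i => u (phi i) x).
exists (phi \o psi) => [i j ij|y]; first exact/lt_phi/lt_psi.
rewrite inE => /predU1P[-> //|sy] i j ij; apply: (le_phi y sy (psi i) (psi j)).
by move: ij; rewrite leq_eqVlt => /predU1P[->//|/lt_psi/ltnW].
Qed.

Lemma mingens_finite J : finite_set (mingens J).
Proof.
apply: contrapT => /infiniteP/card_leP/unsquash f.
pose u (i : nat) := f (SigSub (mem_set (I : setT i))).
have [i [j [ij le_ij]]] := multinom_good_pair (fun i => val (u i)).
have [Iui _] := set_mem (valP (u i)).
have [_ /(_ _ Iui le_ij) /val_inj eq_ij] := set_mem (valP (u j)).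
have := 'inj_f (in_setT _) (in_setT _) eq_ij => /(congr1 val) /= eq.
by rewrite eq ltnn in ij.
Qed.

Lemma lcm_gens_ub I m : mingens I m -> (m <= lcm_gens I)%MM.
Proof.
move=> Gm; have : m \in enum_fset (fset_set (mingens I)).
  rewrite -[_ \in _]/(m \in fset_set _) in_fset_set ?inE //.
  exact: mingens_finite.
rewrite /lcm_gens; elim: (enum_fset _) => [//|m' s IHs]; rewrite big_cons inE.
case/predU1P => [->|/IHs le_m]; first exact: lem_mlcml.
exact: lepm_trans le_m (lem_mlcmr _ _).
Qed.

End MonomialIdeals.

Section Polarization.
Variables (K : fieldType) (n : nat).

(* The variables x_{i,j} for 0 <= j < r i: the second index is shifted by one
   with respect to the usual 1 <= j <= r i. *)
Definition polvar (r : 'I_n -> nat) : finType := {i : 'I_n & 'I_(r i)}.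

Definition polX (r : 'I_n -> nat) (i : 'I_n) (j : 'I_(r i)) :
    {mpoly K[#|polvar r|]} :=
  'X_(enum_rank (Tagged (fun i => 'I_(r i)) j : polvar r)).

(* This is the polarization of 'X_[a] as soon as a i <= r i for all i, which
   holds below by [lcm_gens_ub]. *)
Definition polmon (r : 'I_n -> nat) (a : 'X_{1..n}) :
    {mpoly K[#|polvar r|]} :=
  \prod_(i < n) \prod_(j < r i | (j < a i)%N) polX j.

Definition pol_ideal (I : set {mpoly K[n]}) :
    set {mpoly K[#|polvar (lcm_gens I)|]} :=
  ideal_gen [set polmon (lcm_gens I) a | a in mingens I].

End Polarization.
Arguments polX K {n r i} j.
Arguments pol_ideal {K n} I _.

(* Main.v *)
Require Import Defs.
From mathcomp Require Import all_boot all_order all_algebra.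
From mathcomp Require Import ring zify.
From mathcomp Require Import boolp classical_sets.
From mathcomp Require Import mpoly.

(** Write S for the set of monomials of I, let r be the lcm of G(I), and let
P_V denote the prime generated by the variables x_i with i in V.

For a monomial ideal, an associated prime (I : f) is already (I : m) for some
monomial m of f ([prime_colon_monomial]), so v(I) is the least degree of a
monomial m with (I : m) prime. Moreover (I : m) = P_V as soon as m x_i lies
in S for i in V, while m u stays outside S for u a monomial in the other
variables ([colonX_var_prime]). Since S is upward closed and membership in S
only depends on exponents up to r ([monomial_cap]), everything becomes a
question about exponents.

The link with the polarization is [depth]: the exponent of x_i in [depth w] is
the number of leading variables x_(i,0), x_(i,1), and so on, that divide w
before the first one that does not. Then w lies in I(pol) exactly when
[depth w] lies in I ([pol_idealX]).

- v(I(pol)) <= v(I): if (I : m) = P_V, then the polarization w of m, truncated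
  at r, has (I(pol) : w) generated by the x_(i, m_i) with i in V
  ([colon_pol]).

- v(I) <= v(I(pol)): let w be a monomial with (I(pol) : w) = p of degree
  v(I(pol)), and let N = [depth w]. The radical of (I : N) is P_V, where V is
  the set of the s_l. Multiply N by a monomial z in the variables of V, maximal
  among those that keep N z outside I. Then (I : N z) contains P_V. Were it
  larger, multiplying N z by a maximal monomial in the variables outside V
  would produce an associated prime of I properly containing P_V; it is
  embedded, because P_V is itself associated to I, against the assumption
  ([no_embedded_colon]). So (I : N z) = P_V. Finally N z has degree at most
  deg w, even in each x_i separately ([depolarize_colon]): N z is not in I, so
  for i in V the exponent of x_i in N z stays below [depth (w x_(i,j))], where
  x_(i,j) is in p, and this depth is at most 1 + sum_j w_(i,j). *)

Set Implicit Arguments.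
Unset Strict Implicit.
Unset Printing Implicit Defensive.

Import Order.TTheory GRing.Theory.
Local Open Scope classical_set_scope.
Local Open Scope ring_scope.

(** * Ideals generated by a set *)

Section IdealGen.
Variables (R : comNzRingType) (S : set R).

Lemma ideal_gen0 : ideal_gen S 0.
Proof. by exists [::]; rewrite ?big_nil. Qed.

Lemma ideal_genD f g : ideal_gen S f -> ideal_gen S g -> ideal_gen S (f + g).
Proof.
move=> [t tS ->] [u uS ->]; exists (t ++ u); last by rewrite big_cat.
by move=> c; rewrite mem_cat => /orP[/tS|/uS].
Qed.

Lemma ideal_genM a f : ideal_gen S f -> ideal_gen S (a * f).
Proof.
move=> [t tS ->]; exists [seq (a * c.1, c.2) | c <- t].
  by move=> c /mapP[d /tS Sd ->].
by rewrite big_map mulr_sumr; apply: eq_bigr => c _; rewrite mulrA.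
Qed.

Lemma ideal_gen_sum (T : eqType) (t : seq T) (F : T -> R) :
  {in t, forall x, ideal_gen S (F x)} -> ideal_gen S (\sum_(x <- t) F x).
Proof.
elim: t => [|x t IHt] tS; first by rewrite big_nil; exact: ideal_gen0.
rewrite big_cons; apply: ideal_genD; first by apply: tS; exact: mem_head.
by apply: IHt => y ty; apply: tS; rewrite inE ty orbT.
Qed.

End IdealGen.

(** * Monomial ideals and their monomials *)

Section Monomials.
Variables (K : fieldType) (n : nat).
Implicit Types (I P : set {mpoly K[n]}) (f g : {mpoly K[n]}) (m u : 'X_{1..n}).

Lemma msuppM_sub f g m : m \in msupp (f * g) ->
  exists m1 m2, [/\ m1 \in msupp f, m2 \in msupp g & m = (m1 + m2)%MM].
Proof.
by move/msuppM_le/allpairsP => -[[m1 m2] /= [? ? ->]]; exists m1, m2.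
Qed.

(** A multiple c * 'X_[s] of a generator has its support above s, so a monomial
ideal is spanned by the monomials that it contains. *)
Lemma gen_by_msupp S f :
  gen_by S f <-> {in msupp f, forall m, gen_by S 'X_[K, m]}.
Proof.
split=> [[t tS ->] m|Sf]; last first.
  rewrite [f]mpolyE; apply: ideal_gen_sum => m /Sf Sm.
  by rewrite -mul_mpolyC; exact: ideal_genM.
case/msupp_sum_le/flattenP => w /mapP[c]; rewrite mem_filter /= => tc {w}->.
have [s Ss <-] := tS c tc; move=> /msuppM_sub[m1 [m2 [_]]].
rewrite msuppX inE => /eqP -> ->.
by apply/gen_byX; exists s => //; exact: lem_addl.
Qed.

Lemma monomial_msupp I f : monomial_ideal I ->
  I f <-> {in msupp f, forall m, I 'X_[m]}.
Proof. by move=> [S ->]; exact: gen_by_msupp. Qed.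

Lemma monomial0 I : monomial_ideal I -> I 0.
Proof. by move=> [S ->]; exact: ideal_gen0. Qed.

Lemma monomialD I f g : monomial_ideal I -> I f -> I g -> I (f + g).
Proof. by move=> [S ->]; exact: ideal_genD. Qed.

Lemma monomialM I a f : monomial_ideal I -> I f -> I (a * f).
Proof. by move=> [S ->]; exact: ideal_genM. Qed.

Lemma monomial_le I m m' : monomial_ideal I ->
  (m <= m')%MM -> I 'X_[m] -> I 'X_[m'].
Proof.
move=> [S ->] mm' /gen_byX[s Ss sm]; apply/gen_byX; exists s => //.
exact: lepm_trans mm'.
Qed.

(** The minimal generators have exponents at most [lcm_gens I], so larger
exponents are of no help for belonging to I. *)
Lemma monomial_cap I m m' : monomial_ideal I -> I 'X_[m] ->
  (forall i, minn (m i) (lcm_gens I i) <= m' i)%N -> I 'X_[m'].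
Proof.
move=> monI /mingens_below[s Gs sm] mm'; apply: (@monomial_le _ s) => //.
  apply/mnm_lepP => i; apply: leq_trans (mm' i); rewrite leq_min.
  by rewrite (mnm_lepP sm) (mnm_lepP (lcm_gens_ub Gs)).
by case: Gs.
Qed.

Lemma colonX I m f : monomial_ideal I ->
  colon I 'X_[m] f <-> {in msupp f, forall u, I 'X_[m + u]}.
Proof.
move=> monI; rewrite /colon /= (monomial_msupp _ monI); split=> If u.
  by move=> fu; apply: If; rewrite (perm_mem (msuppMX _ _)) map_f.
by rewrite (perm_mem (msuppMX _ _)) => /mapP[v /If + ->].
Qed.

(** * Primes generated by variables *)

Definition var_prime (V : set 'I_n) : set {mpoly K[n]} :=
  gen_by [set U_(i)%MM | i in V].

Lemma var_primeX V u : var_prime V 'X_[u] <-> exists2 i, V i & (0 < u i)%N.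
Proof.
split=> [/gen_byX[_ [i Vi <-] /mnm_lepP/(_ i)]|[i Vi ui]].
  by rewrite mnm1E eqxx; exists i.
apply/gen_byX; exists U_(i)%MM; first by exists i.
by apply/mnm_lepP => j; rewrite mnm1E; case: eqP => // <-.
Qed.

(** If f and g are reduced modulo P to polynomials without monomials of P, then
the leading monomial of their product is the product of two monomials outside
P, so this product is not in P unless one of the factors is 0. *)
Lemma monomial_prime P : monomial_ideal P -> ~ P 1 ->
  (forall u v, P 'X_[u + v] -> P 'X_[u] \/ P 'X_[v]) -> is_prime_ideal P.
Proof.
move=> monP P1 PX; have PD f g := @monomialD P f g monP.
have PM a f := @monomialM P a f monP.
split.
  split; rewrite ?in_setE; first exact: monomial0.
    by apply/negP; rewrite in_setE.
  by move=> a f g; rewrite !in_setE => Pf Pg; apply: PD => //; exact: PM.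
have reduce f : exists f0 f1, [/\ f = f0 + f1, P f1 &
    {in msupp f0, forall u, ~ P 'X_[u]}].
  pose Q u := `[< P 'X_[u] >].
  exists (\sum_(u <- msupp f | ~~ Q u) f@_u *: 'X_[u]).
  exists (\sum_(u <- msupp f | Q u) f@_u *: 'X_[u]); split.
  - by rewrite {1}[f]mpolyE (bigID Q) addrC.
  - elim/big_ind: _ => [||u /asboolP Pu]; [exact: monomial0|exact: PD|].
    by rewrite -mul_mpolyC; exact: PM.
  move=> m /msupp_sum_le/flattenP => -[w /mapP[u]]; rewrite mem_filter.
  case/andP => /asboolPn Pu _ {w}-> /msuppZ_le.
  by rewrite msuppX inE => /eqP ->.
move=> f g; rewrite !in_setE => Pfg; apply/orP; rewrite !in_setE.
have [f0 [f1 [deff Pf1 f0P]]] := reduce f.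
have [g0 [g1 [defg Pg1 g0P]]] := reduce g.
have [f00|f0n0] := eqVneq f0 0; first by left; rewrite deff f00 add0r.
have [g00|g0n0] := eqVneq g0 0; first by right; rewrite defg g00 add0r.
have : P (f0 * g0).
  have -> : f0 * g0 = f * g + ((- g) * f1 + (- f0) * g1).
    by rewrite deff defg !mulNr !mulrDl !mulrDr; ring.
  by apply: (PD) => //; apply: PD; exact: PM.
move/(monomial_msupp _ monP)/(_ (mlead (f0 * g0))).
rewrite mlead_supp ?mulf_neq0 // mleadM // => /(_ isT)/PX[].
  by move/f0P; case; exact: mlead_supp.
by move/g0P; case; exact: mlead_supp.
Qed.

Lemma var_prime_ideal V : is_prime_ideal (var_prime V).
Proof.
apply: monomial_prime => [||u v]; first by exists [set U_(i)%MM | i in V].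
  by rewrite -mpolyX0 => /var_primeX[i _]; rewrite mnm0E.
move=> /var_primeX[i Vi]; rewrite mnmDE addn_gt0.
by case/orP => ui; [left|right]; apply/var_primeX; exists i.
Qed.

Lemma colonX_var_prime I V m : monomial_ideal I ->
  (forall i, V i -> I 'X_[m + U_(i)]) ->
  (forall u, (forall i, V i -> u i = 0%N) -> ~ I 'X_[m + u]) ->
  colon I 'X_[m] = var_prime V.
Proof.
move=> monI IV IV'.
have VX u : var_prime V 'X_[u] <-> I 'X_[m + u].
  rewrite var_primeX; split=> [[i Vi ui]|Iu].
    apply: monomial_le (IV i Vi) => //; apply/mnm_lepP => j.
    by rewrite !mnmDE mnm1E leq_add2l; case: eqP => // <-.
  apply: contrapT => noi; apply: (IV' u) => // i Vi; apply/eqP.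
  by rewrite -leqn0 leqNgt; apply/negP => ui; apply: noi; exists i.
apply/seteqP; split=> f.
  move/(colonX _ _ monI) => If; apply/gen_by_msupp => u /If Iu.
  exact/VX.
move/gen_by_msupp => Vf; apply/(colonX _ _ monI) => u /Vf Vu.
exact/VX.
Qed.

(** * Colon ideals that are prime *)

(** The leading monomial x of g multiplies the leading term of f into I, since
the product of the leading monomials is a monomial of g * f. So x * f may be
replaced by x * (f - its leading term), which has fewer terms. *)
Lemma mlead_colon I f g : monomial_ideal I -> g != 0 ->
  I (g * f) -> exists k, I ('X_[mlead g] ^+ k * f).
Proof.
move=> monI g0.
have [k] := ubnP (size (msupp f)); elim: k f => // k IHk f lt_fk Igf.
have [->|f0] := eqVneq f 0.
  by exists 0%N; rewrite mulr0; exact: monomial0.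
pose t := f@_(mlead f) *: 'X_[mlead f].
have It : I ('X_[mlead g] * t).
  rewrite -scalerAr -mpolyXD -mul_mpolyC -mleadM //; apply: monomialM => //.
  by apply: (proj1 (monomial_msupp _ monI) Igf); rewrite mlead_supp ?mulf_neq0.
have [||j Ij] := IHk ('X_[mlead g] * (f - t)).
- rewrite mulrC (perm_size (msuppMX _ _)) size_map.
  rewrite (perm_size (msupp_rem _ _)) size_rem ?mlead_supp //.
  by case: (msupp f) lt_fk (mlead_supp f0).
- have -> : g * ('X_[mlead g] * (f - t)) =
      'X_[mlead g] * (g * f) + - g * ('X_[mlead g] * t) by ring.
  by apply: monomialD => //; apply: monomialM.
exists j.+1; have -> : 'X_[mlead g] ^+ j.+1 * f =
    'X_[mlead g] ^+ j * ('X_[mlead g] * (f - t)) +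
    'X_[mlead g] ^+ j * ('X_[mlead g] * t) by rewrite exprSr; ring.
by apply: monomialD => //; apply: monomialM.
Qed.

Section Prime.
Variable P : set {mpoly K[n]}.
Hypothesis primeP : is_prime_ideal P.

Lemma primeD f g : P f -> P g -> P (f + g).
Proof.
case: primeP => -[_ _ PD] _ Pf Pg.
by have := PD 1 f g; rewrite !in_setE mul1r; apply.
Qed.

Lemma prime_not1 : ~ P 1.
Proof. by case: primeP => -[_ /negP + _] _; rewrite in_setE. Qed.

Lemma primeM f g : P (f * g) -> P f \/ P g.
Proof.
case: primeP => _ /(_ f g) + Pfg; rewrite !in_setE => /(_ Pfg)/orP.
by rewrite !in_setE.
Qed.

Lemma primeMl a f : P f -> P (a * f).
Proof.
case: primeP => -[P0 _ PD] _ Pf.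
by have := PD a f 0; rewrite !in_setE addr0; apply => //; rewrite -in_setE.
Qed.

Lemma primeX f k : P (f ^+ k) -> P f.
Proof.
elim: k => [/prime_not1//|k IHk]; rewrite exprS.
by move/primeM => [].
Qed.

Lemma prime_prod (T : eqType) (t : seq T) (F : T -> {mpoly K[n]}) :
  P (\prod_(x <- t) F x) -> exists2 x, x \in t & P (F x).
Proof.
elim: t => [|x t IHt]; first by rewrite big_nil => /prime_not1.
rewrite big_cons => /primeM[Px|/IHt[y ty Py]].
  by exists x; rewrite ?mem_head.
by exists y; rewrite ?inE ?ty ?orbT.
Qed.

Lemma prime_monomial u : P 'X_[u] -> exists2 i, P 'X_i & (0 < u i)%N.
Proof.
have [k] := ubnP (mdeg u); elim: k u => // k IHk u ltuk Pu.
have [u0|] := eqVneq u 0%MM.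
  by move: Pu; rewrite u0 mpolyX0 => /prime_not1.
rewrite -mdeg_eq0 mdegE sum_nat_eq0 => /forallPn[i]; rewrite -lt0n /= => ui.
have defu : u = (U_(i) + (u - U_(i)))%MM.
  rewrite addmC submK //; apply/mnm_lepP => j.
  by rewrite mnm1E; case: eqP => // <-.
move: Pu; rewrite defu mpolyXD => /primeM[Pi|Pu'].
  by exists i => //; rewrite -defu.
have [|j Pj uj] := IHk _ _ Pu'.
  by move: ltuk; rewrite {1}defu mdegD mdeg1.
by exists j => //; rewrite mnmDE ltn_addl.
Qed.

(** Associated primes of a monomial ideal are monomial: by [mlead_colon] and
primality, P contains the leading monomial of each of its elements. *)
Lemma prime_colon_msupp I f : monomial_ideal I -> colon I f = P ->
  {in P, forall g, {in msupp g, forall u, P 'X_[u]}}.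
Proof.
move=> monI defP g; rewrite in_setE.
have [k] := ubnP (size (msupp g)); elim: k g => // k IHk g ltgk Pg u.
have [->|g0] := eqVneq g 0; first by rewrite msupp0.
have Plead : P 'X_[mlead g].
  have [j] : exists j, I ('X_[mlead g] ^+ j * f).
    by apply: mlead_colon => //; rewrite -[I _]/(colon I f g) defP.
  by rewrite -[I _]/(colon I f _) defP; exact: primeX.
have [-> //|uNlead ug] := eqVneq u (mlead g).
apply: (IHk (g - g@_(mlead g) *: 'X_[mlead g])).
- rewrite (perm_size (msupp_rem _ _)) size_rem ?mlead_supp //.
  by case: (msupp g) ltgk (mlead_supp g0).
- by apply: primeD => //; rewrite -mul_mpolyC -mulNr -mpolyCN; exact: primeMl.
- by rewrite (perm_mem (msupp_rem _ _)) mem_rem_uniq ?msupp_uniq // !inE uNlead.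
Qed.

(** As P is monomial, each g in P multiplies all the monomials of f into I, so P
is the intersection of the (I : m) for m in the support of f; a prime that is
a finite intersection of ideals is one of them. *)
Lemma prime_colon_monomial I f : monomial_ideal I -> colon I f = P ->
  exists2 m, m \in msupp f & colon I 'X_[m] = P.
Proof.
move=> monI defP.
have PI m : m \in msupp f -> P `<=` colon I 'X_[m].
  move=> fm g Pg; apply/colonX => // u gu.
  have := prime_colon_msupp monI defP (mem_set Pg) gu.
  rewrite -defP /colon/= => /(proj1 (monomial_msupp _ monI)) /(_ (m + u)%MM).
  by apply; rewrite mulrC (perm_mem (msuppMX _ _)) addmC map_f.
suff [m fm mP] : exists2 m, m \in msupp f & colon I 'X_[m] `<=` P.
  by exists m => //; apply/seteqP; split=> //; exact: PI.
apply: contrapT => noP.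
(* Otherwise choose w m in (I : m) outside P: the product of the w m would
   multiply f into I. *)
have /choice[w wP] : forall m, exists h,
    m \in msupp f -> colon I 'X_[m] h /\ ~ P h.
  move=> m; apply: contrapT => no; apply: noP; exists m.
    by apply: contrapT => nm; apply: no; exists 0.
  by move=> h Ih; apply: contrapT => Ph; apply: no; exists h.
have : P (\prod_(m <- msupp f) w m).
  rewrite -defP /colon/= [X in _ * X]mpolyE mulr_sumr big_seq.
  elim/big_ind: _ => [||m fm]; first exact: monomial0.
    by move=> *; apply: monomialD.
  rewrite (big_rem m fm) /= -mul_mpolyC.
  have [Iwm _] := wP m fm.
  have -> : forall a b c d : {mpoly K[n]}, a * b * (c * d) = (b * c) * (a * d).
    by move=> *; ring.
  exact: monomialM.
by case/prime_prod => m /wP[].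
Qed.

End Prime.

(** * The v-number as a minimum over monomials *)

Lemma vnum_at_monomial I P : monomial_ideal I -> Ass I P ->
  exists2 m, colon I 'X_[m] = P & mdeg m = vnum_at P I.
Proof.
move=> monI [primeP [f /(prime_colon_monomial primeP monI)[m _ defP]]].
have [|[g hg /(prime_colon_monomial primeP monI)[u gu defPu]] _] :=
  @min_natP [set d | exists2 f : {mpoly K[n]}, f \is d.-homog & colon I f = P]
    (mdeg m).
  by exists 'X_[m] => //; rewrite dhomogX.
by exists u => //; move/dhomogP: hg => ->.
Qed.

Lemma vnum_monomial I P : monomial_ideal I -> Ass I P ->
  exists2 m, is_prime_ideal (colon I 'X_[m]) & mdeg m = vnum I.
Proof.
move=> monI IP.
have [|[Q IQ defQ] _] := @min_natP [set vnum_at P I | P in Ass I] (vnum_at P I).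
  by exists P.
have [m mQ degm] := vnum_at_monomial monI IQ.
exists m; last by rewrite degm defQ.
by rewrite mQ; case: IQ.
Qed.

Lemma vnum_le I m : is_prime_ideal (colon I 'X_[m]) -> (vnum I <= mdeg m)%N.
Proof.
move=> primeP; set P := colon I _ in primeP.
have IP : Ass I P by split=> //; exists 'X_[m].
apply: (@leq_trans (vnum_at P I)).
  by apply: (proj2 (@min_natP _ (vnum_at P I) _)); exists P.
apply: (proj2 (@min_natP _ (mdeg m) _));
  by exists 'X_[m] => //; rewrite dhomogX.
Qed.

End Monomials.

(** * Exponents of polarized monomials *)

Lemma sum_ord_ltn r c : (\sum_(j < r) (j < c) = minn r c)%N.
Proof.
elim: r => [|r IHr]; first by rewrite big_ord0 min0n.
by rewrite big_ord_recr /= IHr; lia.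
Qed.

Section Depth.
Variables (n : nat) (r : 'I_n -> nat).
Implicit Types (i : 'I_n) (w : 'X_{1..#|polvar r|}) (a : 'X_{1..n}).

Definition pvar i (j : 'I_(r i)) : 'I_#|polvar r| :=
  enum_rank (Tagged (fun i => 'I_(r i)) j : polvar r).

Lemma pvarP (k : 'I_#|polvar r|) : exists i (j : 'I_(r i)), k = pvar j.
Proof.
exists (tag (enum_val k)), (tagged (enum_val k)).
by rewrite /pvar -[LHS]enum_valK; case: (enum_val k).
Qed.

Lemma pvar_inj i (j j' : 'I_(r i)) : pvar j = pvar j' -> j = j'.
Proof.
move/enum_rank_inj/eqP; rewrite -tag_eqE /tag_eq eqxx tagged_asE.
by move/eqP.
Qed.

Lemma pvar_tag i i' (j : 'I_(r i)) (j' : 'I_(r i')) :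
  pvar j = pvar j' -> i = i'.
Proof. by move/enum_rank_inj/(congr1 tag). Qed.

(** The exponent of the polarization of 'X_[a], with the exponents of a
truncated at r. *)
Definition polexp a : 'X_{1..#|polvar r|} :=
  [multinom ((tagged (enum_val k) < a (tag (enum_val k)))%N : nat)
     | k < #|polvar r|].

Lemma polexpE a i (j : 'I_(r i)) : polexp a (pvar j) = (j < a i)%N.
Proof. by rewrite mnmE enum_rankK. Qed.

Lemma polmonE (K : fieldType) a : polmon K r a = 'X_[polexp a].
Proof.
rewrite mpolyXE_id /polmon sig_big_dep /= big_mkcond /=.
rewrite (reindex (fun k : 'I_#|polvar r| => enum_val k)) /=; last first.
  by exists enum_rank => x _; rewrite ?enum_valK ?enum_rankK.
apply: eq_bigr => k _; have [i [j ->]] := pvarP k.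
by rewrite polexpE /pvar enum_rankK /=; case: ifP.
Qed.

Lemma mdeg_pol w : mdeg w = (\sum_i \sum_(j < r i) w (pvar j))%N.
Proof.
rewrite mdegE sig_big_dep /=.
rewrite (reindex (fun k : 'I_#|polvar r| => enum_val k)) /=.
  apply: eq_bigr => k _; have [i [j ->]] := pvarP k.
  by rewrite {2}/pvar enum_rankK.
by exists enum_rank => x _; rewrite ?enum_valK ?enum_rankK.
Qed.

(** The largest monomial in the original variables, with exponents at most r,
whose polarization divides w. Only the leading consecutive run of each row of w
counts: polarizations contain x_(i,j) only together with all the x_(i,j') for
j' < j. *)
Definition depth w : 'X_{1..n} :=
  [multinom \max_(c < (r i).+1
                  | [forall j : 'I_(r i), (j < c) ==> (0 < w (pvar j))]) c
     | i < n]%N.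

Lemma leq_depth w i c :
  reflect (c <= r i /\ forall j : 'I_(r i), j < c -> 0 < w (pvar j))%N
          (c <= depth w i)%N.
Proof.
rewrite mnmE; pose val_c (c : 'I_(r i).+1) : nat := c.
pose full (c : 'I_(r i).+1) :=
  [forall j : 'I_(r i), (j < c) ==> (0 < w (pvar j))]%N.
apply: (iffP idP) => [|[lecr wc]]; last first.
  have ltcr : (c < (r i).+1)%N by [].
  apply: (@leq_bigmax_cond _ full val_c (Ordinal ltcr)).
  by apply/forallP => j; apply/implyP; exact: wc.
case: c => [//|c] lec; have [|d dP defd] := @eq_bigmax_cond _ full val_c.
  by apply/card_gt0P; exists ord0; apply/forallP.
rewrite defd in lec; split; first exact: leq_trans lec (ltn_ord d).
by move=> j jc; move/forallP/(_ j)/implyP: dP; apply; apply: leq_trans lec.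
Qed.

Lemma depth_le w i : (depth w i <= r i)%N.
Proof. by case: (leq_depth w i _ (leqnn _)). Qed.

Lemma depth_gt0 w i (j : 'I_(r i)) : (j < depth w i)%N -> (0 < w (pvar j))%N.
Proof. by case: (leq_depth w i _ (leqnn _)) => _; apply. Qed.

Lemma depth_row w i : (depth w i <= \sum_(j < r i) w (pvar j))%N.
Proof.
have /minn_idPr <- := depth_le w i; rewrite -sum_ord_ltn.
by apply: leq_sum => j _; case: ltnP => // /depth_gt0.
Qed.

Lemma depthU w i (b : 'I_(r i)) i' : i' != i ->
  (depth (w + U_(pvar b))%MM i' <= depth w i')%N.
Proof.
move=> ne; apply/leq_depth; split=> [|j /depth_gt0]; first exact: depth_le.
rewrite mnmDE mnm1E; case: eqP => [/pvar_tag eq|_]; last by rewrite addn0.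
by rewrite eq eqxx in ne.
Qed.

End Depth.

(** * Colon ideals of the polarization *)

Section PolIdeal.
Variables (K : fieldType) (n : nat) (I : set {mpoly K[n]}).
Hypothesis monI : monomial_ideal I.
Notation r := (lcm_gens I).

Lemma pol_idealE : pol_ideal I = gen_by [set polexp r a | a in mingens I].
Proof.
rewrite /pol_ideal /gen_by image_comp; congr ideal_gen.
by apply: eq_imagel => a _; rewrite polmonE.
Qed.

Lemma pol_monomial : monomial_ideal (pol_ideal I).
Proof. by eexists; exact: pol_idealE. Qed.

(** The polarization of a generator 'X_[a] divides w exactly when 'X_[a]
divides 'X_[depth w]. *)
Lemma pol_idealX w : pol_ideal I 'X_[w] <-> I 'X_[depth w].
Proof.
rewrite pol_idealE gen_byX; split=> [[_ [a Ga <-] aw]|].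
  apply: (monomial_le monI) (proj1 Ga); apply/mnm_lepP => i.
  apply/leq_depth; split=> [|j ja]; first exact: (mnm_lepP (lcm_gens_ub Ga)).
  by move/mnm_lepP: aw => /(_ (pvar j)); rewrite polexpE ja.
case/mingens_below => a Ga /mnm_lepP aw; exists (polexp r a); first by exists a.
apply/mnm_lepP => k; have [i [j ->]] := pvarP k; rewrite polexpE.
by case: ltnP => // ja; apply: depth_gt0; apply: leq_trans (aw i).
Qed.

(** If (I : m) is generated by the x_i with i in V, then polarizing m gives a w
for which (I(pol) : w) is generated by the x_(i, m_i) with i in V: these are
the variables that raise the depth of w at V, and a multiple of w by other
variables has the same depth as w at V. *)
Lemma colon_pol m : is_prime_ideal (colon I 'X_[m]) ->
  exists2 w, is_prime_ideal (colon (pol_ideal I) 'X_[w]) & (mdeg w <= mdeg m)%N.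
Proof.
move=> primeP; pose V : set 'I_n := [set i | I 'X_[m + U_(i)]].
pose V' : set 'I_#|polvar r| :=
  [set k | exists i (j : 'I_(r i)), [/\ k = pvar j, V i & j = m i :> nat]].
exists (polexp r m); last first.
  rewrite mdeg_pol mdegE; apply: leq_sum => i _.
  by under eq_bigr do rewrite polexpE; rewrite sum_ord_ltn geq_minr.
suff -> : colon (pol_ideal I) 'X_[polexp r m] = var_prime V'.
  exact: var_prime_ideal.
apply: (colonX_var_prime pol_monomial) => [_ [i [j [-> Vi jm]]]|u uV'].
  apply/pol_idealX; apply: (monomial_cap monI Vi) => i'.
  apply/leq_depth; split=> [|j']; first exact: geq_minr.
  rewrite leq_min mnmDE mnm1E => /andP[+ _].
  rewrite mnmDE polexpE mnm1E; case: (ltnP j' (m i')) => //= m_j'.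
  case: eqP => [ii'|_]; last by rewrite addn0 ltnNge m_j'.
  case: _ / ii' j' m_j' => j' m_j'.
  rewrite addn1 ltnS leq_eqVlt ltnNge m_j' orbF -jm => /eqP eq_j'.
  by rewrite (val_inj eq_j') eqxx.
(* Off V' the depth of a multiple of w is at most m at V and at most r
   elsewhere, hence at most m + v. *)
pose v := [multinom if `[< V i >] then 0%N else r i | i < n].
move/pol_idealX => Iu; have Iv : I 'X_[m + v].
  apply: (monomial_le monI) Iu; apply/mnm_lepP => i; rewrite mnmDE [v i]mnmE.
  case: asboolP => Vi; last by apply: leq_trans (depth_le _ _) (leq_addl _ _).
  rewrite addn0 leqNgt; apply/negP => lt_m.
  have ltr := leq_trans lt_m (depth_le _ _).
  have := @depth_gt0 _ _ _ _ (Ordinal ltr) lt_m.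
  rewrite mnmDE polexpE /= ltnn uV' //.
  by exists i, (Ordinal ltr).
have /(prime_monomial primeP)[i] : colon I 'X_[m] 'X_[v].
  by rewrite /colon/= -mpolyXD addmC.
rewrite /colon/= -mpolyXD addmC => Vi; rewrite mnmE.
by case: asboolP.
Qed.

(** * Maximal multiples outside the ideal *)

(** Among the z supported on A and bounded by r with N + z outside I, one of
maximal degree; adding a further x_i with i in A either leads into I or
exceeds r. *)
Lemma saturate (A : set 'I_n) N : ~ I 'X_[N] ->
  exists z : 'X_{1..n}, [/\ forall i, ~ A i -> z i = 0%N, ~ I 'X_[N + z] &
    forall i, A i -> (z i < r i)%N -> I 'X_[N + z + U_(i)]].
Proof.
move=> IN.
pose Q d := `[< exists z : 'X_{1..n}, [/\ forall i, ~ A i -> z i = 0%N,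
  (z <= r)%MM, ~ I 'X_[N + z] & mdeg z = d] >].
have exQ : exists d, Q d.
  exists 0%N; apply/asboolP; exists 0%MM; split; rewrite ?mdeg0 ?addm0 //.
    by move=> i _; rewrite mnm0E.
  by apply/mnm_lepP => i; rewrite mnm0E.
have Q_le d : Q d -> (d <= mdeg r)%N.
  case/asboolP => z [_ /mnm_lepP zr _ <-].
  by rewrite !mdegE; apply: leq_sum => i _; exact: zr.
case: (ex_maxnP exQ Q_le) => d /asboolP[z [zA zr Iz degz]] maxd.
exists z; split=> // i Ai zi; apply: contrapT => Izi.
suff : Q d.+1 by move/maxd; rewrite ltnn.
apply/asboolP; exists (z + U_(i))%MM; split.
- move=> i' Ai'; rewrite mnmDE zA // mnm1E; case: eqP => // ii'.
  by rewrite -ii' in Ai'.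
- apply/mnm_lepP => i'; rewrite mnmDE mnm1E; case: eqP => [<-|_].
    by rewrite addn1.
  by rewrite addn0 (mnm_lepP zr).
- by rewrite addmA.
- by rewrite mdegD mdeg1 degz addn1.
Qed.

Section Support.
Variables (V : set 'I_n).

(** When x_i^(r i) multiplies N into I, the exponent of x_i in [saturate]
cannot reach its bound r i, and so x_i itself multiplies N + z into I. *)
Lemma saturate_support N : ~ I 'X_[N] ->
    (forall i, V i -> I 'X_[N + U_(i) *+ r i]) ->
  exists z : 'X_{1..n}, [/\ forall i, ~ V i -> z i = 0%N, ~ I 'X_[N + z] &
    forall i, V i -> I 'X_[N + z + U_(i)]].
Proof.
move=> IN IV; have [z [zV Iz zI]] := saturate V IN; exists z; split=> // i Vi.
apply: zI => //; rewrite ltnNge; apply/negP => rz; apply: Iz.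
apply: (monomial_le monI) (IV i Vi); apply/mnm_lepP => i'.
rewrite !mnmDE leq_add2l mulmnE mnm1E.
by case: eqP => [<-|_]; rewrite ?mul1n ?mul0n.
Qed.

(** The two hypotheses mean that the radical of (I : N) is P_V, so that P_V is
minimal over (I : N), hence associated to I. Concretely, the variables outside V
are inverted by giving them the exponent r, beyond which they have no effect,
and the result is saturated along V. *)
Lemma var_prime_Ass N :
    (forall v : 'X_{1..n}, (forall i, V i -> v i = 0%N) -> ~ I 'X_[N + v]) ->
    (forall i, V i -> I 'X_[N + U_(i) *+ r i]) ->
  Ass I (var_prime V).
Proof.
move=> IN IV; pose v := [multinom if `[< V i >] then 0%N else r i | i < n].
have v0 i : V i -> v i = 0%N by move=> Vi; rewrite mnmE; case: asboolP.
have vr i : ~ V i -> v i = r i by move=> Vi; rewrite mnmE; case: asboolP.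
have [|z [zV Iz zI]] := saturate_support (IN v v0).
  move=> i /IV; apply: monomial_le => //.
  by apply/mnm_lepP => i'; rewrite !mnmDE; lia.
split; first exact: var_prime_ideal.
exists 'X_[N + v + z]; apply: (colonX_var_prime monI) => // u uV Iu.
apply: Iz; apply: (monomial_cap monI Iu) => i.
rewrite !mnmDE; have [/uV->|/vr->] := pselect (V i); last lia.
by rewrite addn0 geq_minl.
Qed.

(** Saturating N along V gives N + z with P_V contained in (I : N + z). A
monomial v in the other variables that multiplies N + z into I would make the
saturation of N + z along the complement of V stop below r at some i outside
V; the colon ideal of this saturation is P_W, where W is V together with all
these i. *)
Lemma no_embedded_colon N :
    ~ (exists2 q, embedded_prime I q & @var_prime K n V `<` q) ->
    (forall v : 'X_{1..n}, (forall i, V i -> v i = 0%N) -> ~ I 'X_[N + v]) ->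
    (forall i, V i -> I 'X_[N + U_(i) *+ r i]) ->
  exists z : 'X_{1..n}, [/\ forall i, ~ V i -> z i = 0%N, ~ I 'X_[N + z] &
    colon I 'X_[N + z] = var_prime V].
Proof.
move=> noE IN IV; have [|z [zV Iz zI]] := saturate_support _ IV.
  by rewrite -[N]addm0; apply: IN => i; rewrite mnm0E.
exists z; split=> //; apply: (colonX_var_prime monI) => // v vV Iv.
have [y [yV Iy yI]] := saturate (~` V) Iz.
pose W := V `|` [set i | (y i < r i)%N].
have colonW : colon I 'X_[N + z + y] = var_prime W.
  apply: (colonX_var_prime monI) => [i Wi|u uW Iu].
    have [Vi|Vi] := pselect (V i).
      apply: (monomial_le monI) (zI i Vi).
      by apply/mnm_lepP => i'; rewrite !mnmDE; lia.
    by apply: yI => //; case: Wi.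
  apply: Iy; apply: (monomial_cap monI Iu) => i.
  have [Wi|Wi] := pselect (W i).
    by rewrite !mnmDE uW // addn0 geq_minl.
  have : (r i <= y i)%N by rewrite leqNgt; apply/negP => ?; apply: Wi; right.
  by rewrite !mnmDE; lia.
have VWproper : @var_prime K n V `<` var_prime W.
  split; last first.
    move=> WV; apply: Iy; apply: (monomial_cap monI Iv) => i.
    have [Vi|Vi] := pselect (V i).
      by rewrite !mnmDE vV //; lia.
    suff : (r i <= y i)%N by rewrite !mnmDE; lia.
    rewrite leqNgt; apply/negP => yi.
    have : var_prime W 'X_[K, U_(i)].
      by apply/var_primeX; exists i; [right|rewrite mnm1E eqxx].
    move=> /WV/var_primeX[i' Vi']; rewrite mnm1E.
    by case: eqP => // ii'; rewrite -ii' in Vi'.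
  apply: gen_by_sub => _ [i Vi <-]; apply/var_primeX.
  by exists i; [left|rewrite mnm1E eqxx].
apply: noE; exists (var_prime W).
  split; first by split; [exact: var_prime_ideal|exists 'X_[N + z + y]].
  by exists (var_prime V); [exact: var_prime_Ass IN IV|exact: VWproper].
exact: VWproper.
Qed.

End Support.

(** Multiplying w by variables outside V' never leads into I(pol), and each
variable of V' does so at once. Through [depth], these two facts become the
conditions of [no_embedded_colon] on N = [depth w]; the second one also bounds
the exponents of z at V. *)
Lemma depolarize_colon (V : set 'I_n) (V' : set 'I_#|polvar r|) w :
    (forall i, V i <-> exists j : 'I_(r i), V' (pvar j)) ->
    ~ (exists2 q, embedded_prime I q & @var_prime K n V `<` q) ->
    colon (pol_ideal I) 'X_[w] = var_prime V' ->
  exists2 m, colon I 'X_[m] = var_prime V & (mdeg m <= mdeg w)%N.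
Proof.
move=> VV' noE colonw.
have polX u : pol_ideal I 'X_[w + u] <-> exists2 k, V' k & (0 < u k)%N.
  rewrite -(var_primeX K) -colonw.
  by rewrite /colon/= -mpolyXD addmC.
have IV i (j : 'I_(r i)) : V' (pvar j) -> I 'X_[depth (w + U_(pvar j))].
  move=> V'j; apply/pol_idealX/polX; exists (pvar j) => //.
  by rewrite mnm1E eqxx.
have [|i /VV'[j V'j]|z [zV Iz colonz]] := no_embedded_colon (N := depth w) noE.
- move=> v vV Iv.
  (* u is the product of all the variables outside V'. *)
  pose u := [multinom (~~ `[< V' k >] : nat) | k < #|polvar r|].
  suff /polX[k V'k] : pol_ideal I 'X_[w + u] by rewrite mnmE; case: asboolP.
  apply/pol_idealX; apply: (monomial_cap monI Iv) => i.
  apply/leq_depth; split=> [|j]; first exact: geq_minr.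
  rewrite leq_min mnmDE => /andP[+ _]; rewrite mnmDE.
  have [Vi|Vi] := pselect (V i).
    by rewrite vV // addn0 => /depth_gt0; rewrite addn_gt0 => ->.
  move=> _; rewrite mnmE asboolF ?addn1 // => V'j.
  by apply/Vi/VV'; exists j.
- apply: (monomial_le monI) (IV _ _ V'j); apply/mnm_lepP => i'.
  rewrite mnmDE mulmnE mnm1E; case: eqP => [<-|/eqP ne].
    by rewrite mul1n (leq_trans (depth_le _ _)) ?leq_addl.
  by rewrite mul0n addn0 depthU // eq_sym.
exists (depth w + z)%MM => //.
(* The bound on the degree holds for each i, between N + z and the i-th row
   of w. *)
rewrite mdegE mdeg_pol; apply: leq_sum => i _.
have [Vi|Vi] := pselect (V i); last first.
  by rewrite mnmDE zV // addn0 depth_row.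
have /VV'[j V'j] := Vi.
have lt_d : ((depth w + z)%MM i < depth (w + U_(pvar j))%MM i)%N.
  rewrite ltnNge; apply/negP => le_d; apply: Iz.
  apply: (monomial_le monI) (IV _ _ V'j); apply/mnm_lepP => i'.
  have [->//|ne] := eqVneq i' i.
  by rewrite mnmDE (leq_trans (depthU _ _ ne)) ?leq_addr.
rewrite -ltnS; apply: leq_trans lt_d _; apply: leq_trans (depth_row _ _) _.
rewrite -addn1; under eq_bigr do rewrite mnmDE.
rewrite big_split leq_add2l /= (bigD1 j) //= mnm1E eqxx big1 // => j' ne.
by rewrite mnm1E; case: eqP => // /pvar_inj ejj'; rewrite ejj' eqxx in ne.
Qed.

End PolIdeal.

(** * The v-number and polarization *)

Theorem theorem3p4 (K : fieldType) (n : nat) (I : set {mpoly K[n]})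
    (properI : is_proper_ideal I) (monomialI : monomial_ideal I)
    (k : nat) (s : 'I_k -> 'I_n) (s_inj : injective s)
    (b : forall l : 'I_k, 'I_(lcm_gens I (s l)))
    (p : set {mpoly K[#|polvar (lcm_gens I)|]})
    (p_def : p = ideal_gen (range (fun l : 'I_k => polX K (b l))))
    (p_ass : Ass (pol_ideal I) p)
    (p_vnum : vnum (pol_ideal I) = vnum_at p (pol_ideal I))
    (no_embedded : ~ exists2 q : set {mpoly K[n]}, embedded_prime I q &
       ideal_gen (range (fun l : 'I_k => 'X_(s l))) `<` q) :
  vnum I = vnum (pol_ideal I).
Proof.
have pE : p = var_prime (range (fun l => pvar (b l))).
  by rewrite p_def /var_prime /gen_by !image_comp.
have sE : ideal_gen (range (fun l => 'X_(s l))) = @var_prime K n (range s).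
  by rewrite /var_prime /gen_by !image_comp.
rewrite sE in no_embedded.
have monpol := pol_monomial I.
have [w colonw degw] := vnum_at_monomial monpol p_ass.
rewrite pE in colonw.
have [|m colonm le_mw] := depolarize_colon monomialI _ no_embedded colonw.
  move=> i; split=> [[l _ <-]|[j [l _ /pvar_tag]]]; first by exists (b l), l.
  by exists l.
have primem : is_prime_ideal (colon I 'X_[m]).
  by rewrite colonm; exact: var_prime_ideal.
apply/eqP; rewrite eqn_leq; apply/andP; split.
  by rewrite p_vnum -degw; apply: leq_trans le_mw; exact: vnum_le.
have Im : Ass I (colon I 'X_[m]) by split=> //; exists 'X_[m].
have [u primeu <-] := vnum_monomial monomialI Im.
have [v primev le_vu] := colon_pol monomialI primeu.
by apply: leq_trans le_vu; exact: vnum_le.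
Qed.
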